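(* For every integer $k$ with $3 \leq k \leq 8$, there is a planar graph $G$ with girth $k$ such that $\mathrm{col}_g(G) = 5$. As a consequence, $\mathrm{col}_g(\mathcal{P}_k) \geq 5$ for every such $k$.
   Context: Graphs are finite and simple. The girth of a graph is the length of its shortest cycle (infinite if the graph has no cycle). The marking game on a graph $G$ is played by two players, Alice and Bob, with Alice playing first. They alternately mark an unmarked vertex of $G$ until all vertices are marked. For each vertex $v$, let $b(v)$ be the number of neighbors of $v$ that are marked before $v$ is marked. The game coloring number of $G$, denoted $\mathrm{col}_g(G)$, is the least $s$ such that Alice has a strategy guaranteeing that, whatever Bob plays, $b(v)+1 \leq s$ for every vertex $v$ of $G$. For a family of graphs $\mathcal{H}$, define $\mathrm{col}_g(\mathcal{H}) := \max\{\mathrm{col}_g(G) : G \in \mathcal{H}\}$. The family $\mathcal{P}_k$ is the family of planar graphs of girth at least $k$. *)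

(* Defs.v *)
From HB Require Import structures.
From mathcomp Require Import all_boot all_order all_algebra.
From mathcomp Require Import all_classical all_reals all_analysis.

Set Implicit Arguments.
Unset Strict Implicit.
Unset Printing Implicit Defensive.

Import Order.TTheory GRing.Theory Num.Theory.
Import numFieldNormedType.Exports.

Local Open Scope classical_set_scope.
Local Open Scope ring_scope.

(* The plane is R * R with the product topology. *)

Record sgraph := SGraph {
  vertex :> finType;
  adj : rel vertex;
  adj_sym : symmetric adj;
  adj_irrefl : irreflexive adj }.

Definition is_cycle (G : sgraph) (c : seq G) : bool :=
  (2 < size c)%N && ucycleb (@adj G) c.

(* Equals +oo when G has no cycle, as ereal_inf set0 = +oo. *)
Definition girth (R : realType) (G : sgraph) : \bar R :=
  ereal_inf [set (size c)%:R%:E | c in [set c : seq G | is_cycle c]].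

Definition is_arc (R : realType) (A : set (R * R)) (x y : R * R) : Prop :=
  exists f : R -> R * R,
    [/\ {within `[0, 1], continuous f}, set_inj `[0, 1] f,
        f 0 = x, f 1 = y & A = f @` `[0, 1]].

(* Topological planarity: vertices are distinct points, the edge uv is an arc
   E u v joining its two ends and passing through no other vertex, and distinct
   edges meet only in common ends. *)
Definition planar (R : realType) (G : sgraph) : Prop :=
  exists (pos : G -> R * R) (E : G -> G -> set (R * R)),
    [/\ injective pos,
        forall u v, adj u v ->
          E u v = E v u /\ is_arc (E u v) (pos u) (pos v),
        forall u v w, adj u v -> E u v (pos w) -> w \in [set u; v]%SET
      & forall u v x y, adj u v -> adj x y -> [set u; v]%SET != [set x; y]%SET ->
          E u v `&` E x y `<=`
            pos @` [set w | w \in [set u; v]%SET /\ w \in [set x; y]%SET]].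

(* A position of the marking game is the sequence of vertices marked so far, in
   order; Alice moves at the positions of even size.  The codomain is an option
   type only so that strategies also exist on the graph with no vertex. *)
Definition strategy (G : sgraph) : Type := seq G -> option G.

Definition legal (G : sgraph) (sigma : strategy G) : Prop :=
  forall h : seq G, uniq h -> (size h < #|G|)%N -> ~~ odd (size h) ->
    exists2 v, sigma h = Some v & v \notin h.

Definition complete_play (G : sgraph) (p : seq G) : bool :=
  uniq p && [forall v, v \in p].

Definition follows (G : sgraph) (sigma : strategy G) (p : seq G) : Prop :=
  forall (h t : seq G) (v : G), p = h ++ v :: t -> ~~ odd (size h) ->
    sigma h = Some v.

Definition back_degree (G : sgraph) (p : seq G) (v : G) : nat :=
  #|[set u : G | adj u v && (index u p < index v p)%N]%SET|.

Definition Alice_guarantees (G : sgraph) (s : nat) : Prop :=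
  exists2 sigma : strategy G, legal sigma &
    forall p, complete_play p -> follows sigma p ->
      forall v : G, (back_degree p v + 1 <= s)%N.

Lemma Alice_guarantees_ex (G : sgraph) :
  exists s, `[< Alice_guarantees G s >].
Proof.
exists (#|G| + 1)%N; apply/asboolP.
exists (fun h => [pick v | v \notin h]).
  move=> h _ hG _; case: pickP => [v vh|all_in]; first by exists v.
  suff : (#|G| <= size h)%N by rewrite leqNgt hG.
  by rewrite cardE; apply: uniq_leq_size (enum_uniq _) _ => v _;
    apply/negbNE/negbT/all_in.
by move=> p _ _ v; rewrite leq_add2r max_card.
Qed.

Definition col_g (G : sgraph) : nat := ex_minn (Alice_guarantees_ex G).

(* The maximum of col_g over H whenever it exists (see col_g_familyE); the
   value is +oo if col_g is unbounded on H.  A family is a plain predicate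
   because set sgraph is universe-inconsistent. *)
Definition col_g_family (R : realType) (H : sgraph -> Prop) : \bar R :=
  ereal_sup [set x | exists2 G, H G & x = (col_g G)%:R%:E].

Lemma col_g_familyE (R : realType) (H : sgraph -> Prop) (G0 : sgraph) :
  H G0 -> (forall G, H G -> (col_g G <= col_g G0)%N) ->
  col_g_family R H = (col_g G0)%:R%:E.
Proof.
move=> HG0 max0; apply/eqP; rewrite eq_le; apply/andP; split.
  by apply: ge_ereal_sup => _ [G HG ->]; rewrite lee_fin ler_nat max0.
by apply: ereal_sup_ubound; exists G0.
Qed.

Definition planar_girth_ge (R : realType) (k : nat) (G : sgraph) : Prop :=
  planar R G /\ (k%:R%:E <= girth R G)%E.

(* Main.v *)
(* The graph is a core of maximum degree 3, pendant leaves bringing the degree of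
   every core vertex to 4, and a disjoint k-cycle that fixes the girth.  The core
   consists of 20 concentric 9-cycles joined by spokes, and all its bounded faces
   but the innermost have length 8.  As the maximum degree is 4, Alice guarantees 5.

   Bob beats 4.  Write c(v) for the number of marked neighbours of an unmarked
   core vertex v and d(v) for its number of core neighbours.  If c(v) >= 3 when
   Bob is to move, he marks the fourth neighbour of v and wins, so c <= 2 at all
   his turns.  Bob watches two potentials, with U the set of unmarked core
   vertices:
     Phi = sum over U of (d + 2 #marked leaves + #marked core neighbours - 4),
     Psi = sum over U of (3d + 2 #marked leaves + #marked core neighbours - 8).
   Marking a leaf of a vertex of U adds 2 to both; marking v in U adds 4 - 2 c(v)
   to Phi and 8 - 2 d(v) - 2 c(v) to Psi; and both vanish once the core is
   exhausted.  Hence Bob wins if he can keep one of them positive.  He can for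
   Phi, by marking leaves, then vertices with c <= 1; when neither is left, every
   v in U has c(v) = 2 and two neighbours in U, and marking v makes a double
   threat.  If Psi > 0, he marks leaves of vertices v with c(v) <= 1 or
   d(v) <= 2; when none is left, Phi > 0.  At the start Psi = -18, and Bob brings
   it above 0 by marking ten core vertices with d = 2 chosen so that everything
   within distance 2 is unmarked: he gains 4 each time and Alice takes back at
   most 2. *)

From Stdlib Require Import BinInt.
Require Import Defs.
From HB Require Import structures.
From mathcomp Require Import all_boot all_order all_algebra.
From mathcomp Require Import all_classical all_reals all_analysis.
From mathcomp Require Import zify ssrZ ring lra.

Set Implicit Arguments.
Unset Strict Implicit.
Unset Printing Implicit Defensive.

Import Order.TTheory GRing.Theory Num.Theory.
Import numFieldNormedType.Exports.

Local Open Scope ring_scope.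

Delimit Scope Z_scope with BZ.

(** * Potentials *)

Definition nbr (G : sgraph) (v : G) : {set G} := [set u | adj u v]%SET.

Lemma in_nbr (G : sgraph) (u v : G) : (u \in nbr v) = adj u v.
Proof. by rewrite inE. Qed.

Lemma nbr_sym (G : sgraph) (u v : G) : (u \in nbr v) = (v \in nbr u).
Proof. by rewrite !in_nbr adj_sym. Qed.

Lemma nbr_irrefl (G : sgraph) (v : G) : v \notin nbr v.
Proof. by rewrite in_nbr adj_irrefl. Qed.

Section Potential.
Import mathcomp.boot.finset.

Lemma cards1I (T : finType) (x : T) (A : {set T}) :
  #|([set x] :&: A)%SET| = (x \in A) :> nat.
Proof.
case: (boolP (x \in A)) => xA.
  by rewrite (setIidPl _) ?cards1 // sub1set.
by rewrite disjoint_setI0 ?cards0 // disjoints1.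
Qed.

Lemma cardsIU1 (T : finType) (x : T) (A S : {set T}) : x \notin S ->
  #|(A :&: (x |: S))%SET| = ((x \in A) + #|(A :&: S)%SET|)%N.
Proof.
move=> xS; rewrite setIUr cardsU [X in (_ - X)%N](_ : _ = 0%N); last first.
  apply/eqP; rewrite cards_eq0; apply/eqP/setP => y; rewrite !inE.
  by apply/negP => /andP[/andP[_ /eqP->]] /andP[_]; apply/negP.
by rewrite subn0 setIC cards1I.
Qed.

Lemma sum_mem_card (T : finType) (A B : {set T}) :
  \sum_(v in B) (v \in A)%:Z = #|(A :&: B)%SET|%:Z.
Proof.
rewrite -sum1_card (big_morph Posz PoszD (erefl _)) big_mkcond [RHS]big_mkcond.
by apply: eq_bigr => v _; rewrite inE; case: (v \in A); case: (v \in B).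
Qed.

Variables (G : sgraph) (K : {set G}).
Implicit Types (S : {set G}) (u v w a : G).

Definition marked S v : nat := #|nbr v :&: S|.

Definition core_deg v : nat := #|nbr v :&: K|.

(* A marked leaf counts twice, a marked core neighbour once. *)
Definition potential (alpha : G -> int) S : int :=
  \sum_(v in K :\: S)
    (alpha v + (marked S v)%:Z + (marked (S :\: K) v)%:Z).

Lemma markedU1 S w v : w \notin S ->
  marked (w |: S) v = ((w \in nbr v) + marked S v)%N.
Proof. exact: cardsIU1. Qed.

Lemma markedID S v :
  marked S v = (marked (S :&: K) v + marked (S :\: K) v)%N.
Proof. by rewrite /marked -(cardsID K) -setIA -setIDA. Qed.

Lemma core_degID S v :
  core_deg v = (marked (S :&: K) v + #|nbr v :&: (K :\: S)|)%N.
Proof. by rewrite /marked /core_deg -(cardsID S) -setIA -setIDA [K :&: S]setIC. Qed.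

(** The term of [a] leaves the sum and each unmarked core neighbour of [a] gains 1. Marked leaves of
    [a] are lost twice in its term, marked core neighbours once there and once among the neighbours
    that no longer gain, whence the factor 2. *)
Lemma potential_core alpha S a : a \in K -> a \notin S ->
  potential alpha (a |: S) =
  potential alpha S + (core_deg a)%:Z - alpha a - (marked S a)%:Z *+ 2.
Proof.
move=> aK aS.
have aKS : a \in K :\: S by rewrite inE aS.
rewrite /potential (big_setD1 _ aKS) /=.
rewrite setUC setDUr -/(a |: S) [(K :\: S) :&: _]setIDA (setIidPl (subsetDl _ _)).
rewrite (eq_bigr (fun v => alpha v + (marked S v)%:Z + (marked (S :\: K) v)%:Z
                           + (v \in nbr a)%:Z)); last first.
  move=> v _; rewrite setUC markedU1 // nbr_sym.
  have -> : (a |: S) :\: K = S :\: K.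
    by apply/setP => x; rewrite !inE; case: eqP => // ->; rewrite aK.
  by case: (v \in nbr a); lia.
rewrite big_split /= sum_mem_card.
have -> : nbr a :&: ((K :\: S) :\ a) = nbr a :&: (K :\: S).
  apply/setP => x; rewrite !inE; case: (x =P a) => [->|] //=.
  by rewrite adj_irrefl.
have := markedID S a; have := core_degID S a; lia.
Qed.

Lemma potential_leaf alpha S w : w \notin K -> w \notin S ->
  potential alpha (w |: S) = potential alpha S + #|nbr w :&: (K :\: S)|%:Z *+ 2.
Proof.
move=> wK wS; rewrite /potential.
have -> : K :\: (w |: S) = K :\: S.
  by apply/setP => x; rewrite !inE; case: eqP => // ->; rewrite (negPf wK) !andbF.
have -> : (w |: S) :\: K = w |: (S :\: K).
  by apply/setP => x; rewrite !inE; case: eqP => // ->; rewrite (negPf wK).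
rewrite (eq_bigr (fun v => alpha v + (marked S v)%:Z + (marked (S :\: K) v)%:Z
                           + (v \in nbr w)%:Z + (v \in nbr w)%:Z)); last first.
  move=> v _; rewrite !markedU1 ?inE ?(negPf wS) ?andbF //.
  by rewrite [adj v w]adj_sym; case: (adj w v); lia.
by rewrite big_split /= big_split /= sum_mem_card mulr2n addrA.
Qed.

Lemma potential_exhausted alpha S : K \subset S -> potential alpha S = 0.
Proof.
by move=> KS; rewrite /potential (_ : K :\: S = set0) ?big_set0 //; apply/eqP;
  rewrite setD_eq0.
Qed.

Lemma potential_gt0 alpha S : 0 < potential alpha S ->
  exists2 v, v \in K & v \notin S.
Proof.
move=> p_gt0; have : ~~ (K \subset S).
  by apply/negP => /(potential_exhausted alpha) p0; rewrite p0 in p_gt0.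
by case/subsetPn => v; exists v.
Qed.

End Potential.

(** * Bob's strategy *)

Section BobWins.
Import mathcomp.boot.finset.

Variables (G : sgraph) (K : {set G}).
Hypothesis deg4 : forall v, v \in K -> #|nbr v| = 4%N.
Hypothesis core_deg_le3 : forall v, v \in K -> (core_deg K v <= 3)%N.
Hypothesis leaf_deg : forall w, w \notin K -> (core_deg K w <= 1)%N.

(** Stands for the positions at which Bob is to move against a strategy supposed to guarantee 4; the
    potential argument sees the strategy only through the two hypotheses that follow. *)
Variable bob_turn : {set G} -> Prop.
Hypothesis bob_turn_marked : forall S v,
  bob_turn S -> v \in K -> v \notin S -> (marked S v <= 2)%N.
Hypothesis bob_moves : forall S w, bob_turn S -> w \notin S ->
  w |: S = setT \/
  exists a, [/\ a \notin w |: S, (marked (w |: S) a <= 3)%N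
              & bob_turn (a |: (w |: S))].

Implicit Types (S : {set G}) (u v w a : G).

(* Twice the excess of the number of edges inside K :\: S over the sum of 2 - c. *)
Definition Phi S : int := potential K (fun v => (core_deg K v)%:Z - 4) S.

Definition Psi S : int := potential K (fun v => (core_deg K v)%:Z *+ 3 - 8) S.

(** A core reply changes [Phi] by 4 - 2c with c at most 3, and a leaf reply never lowers it. *)
Lemma Phi_reply S a : a \notin S -> (marked S a <= 3)%N ->
  Phi S - 2 <= Phi (a |: S).
Proof.
move=> aS; rewrite /Phi; case: (boolP (a \in K)) => aK.
  rewrite potential_core //; lia.
rewrite potential_leaf //; lia.
Qed.

(** A core reply changes [Psi] by 8 - 2d - 2c, which is at least -2 exactly when d + c is at most
    5. *)
Lemma Psi_reply S a : a \notin S ->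
  (a \in K -> core_deg K a + marked S a <= 5)%N -> Psi S - 2 <= Psi (a |: S).
Proof.
move=> aS; rewrite /Psi; case: (boolP (a \in K)) => aK.
  move=> /(_ isT); rewrite potential_core //; lia.
rewrite potential_leaf //; lia.
Qed.

Lemma potential_leaf_ge alpha S v w : v \in K -> v \notin S ->
  w \notin K -> w \notin S -> w \in nbr v ->
  potential K alpha S + 2 <= potential K alpha (w |: S).
Proof.
move=> vK vS wK wS wv; rewrite potential_leaf //.
suff : (0 < #|nbr w :&: (K :\: S)|)%N by lia.
by apply/card_gt0P; exists v; rewrite !inE vK vS -in_nbr nbr_sym wv.
Qed.

Lemma card_subU1 S w : w \notin S -> (#|~: (w |: S)| < #|~: S|)%N.
Proof.
move=> wS; apply: proper_card; apply/properP; split.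
  by rewrite setCS subsetUr.
by exists w; rewrite !inE ?wS // eqxx.
Qed.

Lemma degE S v : v \in K ->
  (marked S v + #|nbr v :&: (K :\: S)| + #|nbr v :\: (S :|: K)|)%N = 4%N.
Proof.
move=> vK; rewrite -(deg4 vK) -(cardsID S (nbr v)) /marked -addnA; congr addn.
rewrite -(cardsID K (nbr v :\: S)) setDDl; congr addn.
by apply: eq_card => x; rewrite !inE; case: (adj x v); case: (x \in S).
Qed.

(** Bob's win takes the form of a bound: a positive potential contradicts the supposed guarantee.
    Induction on the number of unmarked vertices. *)
Lemma bob_wins_Phi S : bob_turn S -> Phi S <= 0.
Proof.
move: {2}#|_|.+1 (ltnSn #|~: S|) => n; elim: n S => // n IHn S Sn BS.
rewrite leNgt; apply/negP => Phi_gt0.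
have [v0 v0K v0S] := potential_gt0 Phi_gt0.
(* Alice takes back at most the 2 gained, so [Phi] would stay positive with fewer vertices unmarked;
   a full board would have [Phi] zero. *)
have win w : w \notin S -> Phi S + 2 <= Phi (w |: S) -> False.
  move=> wS ge2; case: (bob_moves BS wS) => [full|[a [aS a3 /IHn]]].
    by move: ge2; rewrite full {2}/Phi potential_exhausted ?subsetT //; lia.
  have := card_subU1 wS; have := card_subU1 aS.
  have := Phi_reply aS a3; lia.
have no_leaf v : v \in K -> v \notin S -> #|nbr v :\: (S :|: K)| = 0%N.
  move=> vK vS; apply/eqP; rewrite cards_eq0; apply/eqP/setP => w; rewrite [RHS]inE.
  apply/negP; rewrite in_setD in_setU negb_or => /andP[/andP[wS wK] wv].
  by apply: (win w) => //; apply: potential_leaf_ge vS wK wS wv.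
have marked2 v : v \in K -> v \notin S -> marked S v = 2%N.
  move=> vK vS; have := bob_turn_marked BS vK vS.
  case: (ltngtP (marked S v) 2) => // lt2 _; exfalso; apply: (win v) => //.
  rewrite /Phi potential_core //; lia.
(* Of the four neighbours two are marked and no unmarked one is a leaf, so two lie in the unmarked
   core. *)
have : (1 < #|nbr v0 :&: (K :\: S)|)%N.
  by have := degE S v0K; rewrite no_leaf // marked2 //; lia.
case/card_gt1P => x [y []]; rewrite !inE => /and3P[xv xS xK] /and3P[yv yS yK] xy.
have x3 z : adj z v0 -> z \notin S -> z \in K ->
    z != v0 /\ (marked (v0 |: S) z = 3%N).
  move=> zv zS zK; split; last by rewrite markedU1 // marked2 // nbr_sym in_nbr zv.
  by apply/eqP => zE; rewrite zE adj_irrefl in zv.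
have [xv0 x3'] := x3 x xv xS xK; have [yv0 y3'] := x3 y yv yS yK.
case: (bob_moves BS v0S) => [/setP/(_ x)|[a [aS a3 BS']]].
  by rewrite !inE (negPf xv0) (negPf xS).
(* The double threat: Alice's single reply [a] leaves [x] or [y] unmarked with three marked
   neighbours. *)
have [z [zv0 zS zK z3 za]] : exists z,
    [/\ z != v0, z \notin S, z \in K, marked (v0 |: S) z = 3%N & z != a].
  by have [xa|xa] := eqVneq x a; [exists y | exists x]; split=> //;
    rewrite -xa eq_sym.
have := bob_turn_marked BS' zK; rewrite markedU1 // z3 !inE (negPf za) (negPf zv0).
by rewrite addnC => /(_ zS).
Qed.

Lemma bob_wins_Psi S : bob_turn S -> Psi S <= 0.
Proof.
move: {2}#|_|.+1 (ltnSn #|~: S|) => n; elim: n S => // n IHn S Sn BS.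
rewrite leNgt; apply/negP => Psi_gt0.
have [v0 v0K v0S] := potential_gt0 Psi_gt0.
(* Marking a free leaf of [v] gains 2, and the reply costs more than 2 only if it is [v] itself with
   c(v) = 2 before the leaf and d(v) = 3. *)
have no_leaf v w : v \in K -> v \notin S -> w \notin S -> w \notin K ->
    w \in nbr v -> (marked S v = 2 /\ core_deg K v = 3)%N.
  move=> vK vS wS wK wv.
  have := bob_turn_marked BS vK vS; have := core_deg_le3 vK => d3 c2.
  case: (boolP ((core_deg K v == 3) && (marked S v == 2))%N) => [|bad].
    by move=> /andP[/eqP-> /eqP->].
  exfalso; have ge2 : Psi S + 2 <= Psi (w |: S) by apply: potential_leaf_ge vS wK wS wv.
  case: (bob_moves BS wS) => [full|[a [aS a3 /IHn]]].
    by move: ge2; rewrite full {2}/Psi potential_exhausted ?subsetT //; lia.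
  have := card_subU1 wS; have := card_subU1 aS.
  have : Psi (w |: S) - 2 <= Psi (a |: (w |: S)); last by lia.
  apply: Psi_reply => // aK; have := core_deg_le3 aK.
  have [av|av] := eqVneq a v.
    by move: a3; rewrite av markedU1 // wv; move: bad; lia.
  have aS' : a \notin S by move: aS; rewrite !inE negb_or => /andP[].
  (* The leaf [w] already has [v] as its only core neighbour, so marking it leaves c(a) at most
     2. *)
  have aw : w \notin nbr a.
    apply/negP => aw; have := leaf_deg wK; rewrite leqNgt => /negP; apply.
    apply/card_gt1P; exists a, v; split=> //; rewrite !inE ?aK ?vK andbT.
      by rewrite adj_sym -in_nbr.
    by rewrite adj_sym -in_nbr.
  rewrite markedU1 // (negPf aw) add0n => ad3.
  exact: leq_add ad3 (bob_turn_marked BS aK aS').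
have : Phi S <= 0 by apply: bob_wins_Phi.
rewrite leNgt => /negP; apply; rewrite /Phi /potential.
(* If all leaves of v are marked there are 4 - d of them, so the term equals c, which is at least 4
   - d > 0. Otherwise c = 2 and d = 3 make it at least 1. *)
have term v : v \in K :\: S ->
    0 < (core_deg K v)%:Z - 4 + (marked S v)%:Z + (marked (S :\: K) v)%:Z :> int.
  rewrite inE => /andP[vS vK].
  have := degE S vK; have := core_degID K S v; have := core_deg_le3 vK.
  have := markedID K S v.
  case: (posnP #|nbr v :\: (S :|: K)|) => [->|]; first by lia.
  case/card_gt0P => w; rewrite in_setD in_setU negb_or => /andP[/andP[wS wK] wv].
  have [c2 d3] := no_leaf v w vK vS wS wK wv; rewrite c2 d3; lia.
rewrite (big_setD1 v0) /=; last by rewrite inE v0S.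
apply: ltr_wpDr; last by apply: term; rewrite inE v0S.
by apply: sumr_ge0 => v; rewrite inE => /andP[_ /term/ltW].
Qed.

(** * Bob's opening on well-separated core vertices *)

Definition ball2 z : {set G} := nbr z :|: \bigcup_(x in nbr z) nbr x.

Variable (Z : {set G}).
Hypothesis Z_core : forall z, z \in Z -> (z \in K) && (core_deg K z <= 2)%N.
Hypothesis Z_far : forall u, (#|[set z in Z | u \in ball2 z]| <= 1)%N.

(** Pigeonhole: if every ball met [S], choosing a common point in each would be injective on [Z],
    since by [Z_far] no vertex lies in two of the balls. *)
Lemma exists_fresh S : (#|S| < #|Z|)%N ->
  exists2 z, z \in Z & [disjoint S & ball2 z].
Proof.
move=> ltSZ; apply/exists_inP; apply: contraT; rewrite negb_exists => /forallP meet.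
have {}meet z : {u | z \in Z -> u \in S :&: ball2 z}.
  case: (boolP (z \in Z)) => zZ; last by exists z.
  have := meet z; rewrite zZ -setI_eq0 => /set0Pn/sigW[u uP].
  by exists u.
suff : (#|Z| <= #|S|)%N by rewrite leqNgt ltSZ.
rewrite -(card_in_imset (f := fun z => sval (meet z))); last first.
  move=> z y zZ yZ eq_meet; apply/eqP; apply: contraT => zy.
  have := Z_far (sval (meet z)); rewrite leqNgt => /negP[].
  apply/card_gt1P; exists z, y; split=> //.
    rewrite in_set; apply/andP; split=> //.
    by have := svalP (meet z) zZ; rewrite in_setI => /andP[].
  rewrite eq_meet in_set; apply/andP; split=> //.
  by have := svalP (meet y) yZ; rewrite in_setI => /andP[].
apply: subset_leq_card; apply/fintype.subsetP => _ /imsetP[z zZ ->].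
by have := svalP (meet z) zZ; rewrite in_setI => /andP[].
Qed.

Hypothesis bob_turn_first : exists a, bob_turn [set a].

(** Alice's first move does not lower [Psi]; each later round adds 4 by Bob's fresh vertex and loses
    at most 2, and the odd size of [S] counts that first move. *)
Lemma bob_opening n : (n.*2 <= #|Z|)%N ->
  exists S, [/\ bob_turn S, #|S| = n.*2.+1 & Psi set0 + n.*2%:Z <= Psi S].
Proof.
elim: n => [_|n IHn nZ].
  have [a Ba] := bob_turn_first; exists [set a]; split=> //; first exact: cards1.
  have a0 : a \notin (set0 : {set G}) by rewrite inE.
  rewrite -(setU0 [set a]) /Psi; case: (boolP (a \in K)) => aK.
    have := core_deg_le3 aK; rewrite potential_core // /marked setI0 cards0; lia.
  by rewrite potential_leaf //; lia.
have [|S [BS cardS PsiS]] := IHn; first by apply: leq_trans nZ; rewrite leq_double.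
have [|z zZ Sz] := @exists_fresh S; first by rewrite cardS; lia.
have /andP[zK z2] := Z_core zZ.
have nbr_free x : x \in nbr z -> x \notin S.
  by move=> xz; apply/negP => /(disjointFr Sz); rewrite inE xz.
have nbr2_free x : x \in nbr z -> marked S x = 0%N.
  move=> xz; apply/eqP; rewrite /marked cards_eq0 setI_eq0 disjoint_sym.
  apply: disjointWr Sz; apply/fintype.subsetP => y yx; rewrite inE.
  by apply/orP; right; apply/bigcupP; exists x.
have /card_gt0P[x xz] : (0 < #|nbr z|)%N by rewrite deg4.
(* [z] is a neighbour of its neighbour [x], and no neighbour of [x] is marked. *)
have zS : z \notin S.
  apply/negP => zS; have /eqP := nbr2_free x xz; rewrite cards_eq0.
  by move=> /eqP/setP/(_ z); rewrite !inE zS adj_sym -in_nbr xz.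
have marked_z : marked S z = 0%N.
  apply/eqP; rewrite cards_eq0; apply/eqP/setP => y; rewrite [RHS]inE in_setI.
  by apply/negP => /andP[/nbr_free/negP].
case: (bob_moves BS zS) => [/setP/(_ x)|[a [aS a3 BS']]].
  rewrite !inE (negPf (nbr_free x xz)) orbF => /eqP xE.
  by move: xz; rewrite xE (negPf (nbr_irrefl _)).
exists (a |: (z |: S)); split=> //.
  by rewrite !cardsU1 zS aS cardS doubleS.
(* A core reply next to [z] has [z] as its only marked neighbour, any other has at most two; core
   degree at most 3 then bounds the loss by 2. This is why distance two around [z] must be clear. *)
have : Psi (z |: S) - 2 <= Psi (a |: (z |: S)).
  apply: Psi_reply => // aK; have := core_deg_le3 aK.
  have aS' : a \notin S by move: aS; rewrite !inE negb_or => /andP[].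
  rewrite markedU1 // nbr_sym; case: (boolP (a \in nbr z)) => [/nbr2_free->|_].
    by rewrite /=; lia.
  by have := bob_turn_marked BS aK aS'; rewrite add0n; lia.
move: PsiS; rewrite {3}/Psi potential_core // marked_z -/(Psi S) doubleS; lia.
Qed.

Lemma bob_wins n : (n.*2 <= #|Z|)%N -> 0 < Psi set0 + n.*2%:Z -> False.
Proof.
move=> nZ gt0; have [S [BS _]] := bob_opening nZ.
have := bob_wins_Psi BS; lia.
Qed.

End BobWins.

(** * From a strategy of Alice to the positions Bob meets *)

Section Plays.
Import mathcomp.boot.finset.

Variables (G : sgraph) (sigma : strategy G).
Implicit Types (h p : seq G) (v w : G).

Lemma follows_rcons h v : follows sigma h ->
  (~~ odd (size h) -> sigma h = Some v) -> follows sigma (rcons h v).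
Proof.
move=> fh hv h' t v'; case/lastP: t => [|t x].
  by rewrite cats1 => /rcons_inj[<- <-].
by rewrite -rcons_cons -rcons_cat => /rcons_inj[hE _]; apply: fh hE.
Qed.

Definition reachable h : Prop := uniq h /\ follows sigma h.

Hypothesis sigma_legal : legal sigma.

Lemma reachable_bob h w : reachable h -> odd (size h) -> w \notin h ->
  reachable (rcons h w).
Proof.
move=> [uh fh] oh wh; split; first by rewrite rcons_uniq wh.
by apply: follows_rcons => //; rewrite oh.
Qed.

Lemma reachable_alice h : reachable h -> ~~ odd (size h) ->
  (size h < #|G|)%N -> exists2 a, a \notin h & reachable (rcons h a).
Proof.
move=> [uh fh] eh hG; have [a sa ah] := sigma_legal uh hG eh; exists a => //.
by split; [rewrite rcons_uniq ah | apply: follows_rcons].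
Qed.

Lemma uniq_full h : uniq h -> ~~ (size h < #|G|)%N -> forall v, v \in h.
Proof.
move=> uh hG v.
apply: contraT => vh; have /card_uniqP cE : uniq (v :: h) by rewrite /= vh.
by have := max_card [in v :: h]; rewrite cE /= (negPf hG).
Qed.

(** Alice's guarantee speaks of complete plays only; this extension lets it apply to partial
    ones. *)
Lemma reachable_complete h : reachable h ->
  exists2 t, complete_play (h ++ t) & follows sigma (h ++ t).
Proof.
move: {2}(#|G| - size h)%N.+1 (ltnSn (#|G| - size h)%N) => n.
elim: n h => // n IHn h hn rh.
have [hG|/(uniq_full rh.1) full] := boolP (size h < #|G|)%N; last first.
  exists [::]; rewrite cats0; last exact: rh.2.
  by rewrite /complete_play rh.1; apply/forallP.
have [v rhv] : exists v, reachable (rcons h v).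
  case: (boolP (odd (size h))) => [oh|/(reachable_alice rh)[]// a _]; last by exists a.
  case: (pickP [pred v | v \notin h]) => [v vh|full].
    by exists v; apply: reachable_bob.
  move: hG; rewrite ltnNge cardE => /negP[].
  by apply: uniq_leq_size (enum_uniq _) _ => v _; have := full v => /negbFE.
have [|t cp fp] := IHn _ _ rhv; first by rewrite size_rcons; lia.
by exists (v :: t); rewrite -cat_rcons.
Qed.

Variables (s : nat).
Hypothesis sigma_wins : forall p, complete_play p -> follows sigma p ->
  forall v, (back_degree p v + 1 <= s.+1)%N.

(** In any completion the vertices of [h] precede [v], so its marked neighbours already count in its
    back degree. *)
Lemma reachable_marked h v : reachable h -> v \notin h ->
  (marked [set x in h] v <= s)%N.
Proof.
move=> rh vh; have [t cp fp] := reachable_complete rh.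
have := sigma_wins cp fp v; rewrite addn1 ltnS; apply: leq_trans.
apply: subset_leq_card; apply/fintype.subsetP => u; rewrite !inE => /andP[-> uh].
by rewrite !index_cat uh (negPf vh) ltn_addr // index_mem.
Qed.

Lemma set_rcons h w : [set x in rcons h w] = w |: [set x in h].
Proof. by apply/setP => x; rewrite !inE mem_rcons inE. Qed.

(** The order of play is forgotten, as the potentials depend on the marked set only; odd size means
    that Bob is to move. *)
Definition bob_position (S : {set G}) : Prop :=
  exists h, [/\ reachable h, odd (size h) & S = [set x in h]].

(** With [s] marked neighbours and degree above [s], some neighbour is still unmarked, and Bob's
    marking it would exceed the bound. *)
Lemma bob_position_marked (S : {set G}) v : bob_position S ->
  (s < #|nbr v|)%N -> v \notin S -> (marked S v < s)%N.
Proof.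
move=> [h [rh oh ->]] s_lt; rewrite inE => vh; rewrite ltnNge; apply/negP => s_le.
have : ~~ (nbr v \subset [set x in h]).
  apply/negP => /setIidPl nE; have := reachable_marked rh vh.
  by rewrite /marked nE leqNgt s_lt.
case/subsetPn => w wv; rewrite inE => wh.
have vw : v != w by apply: contraTneq wv => <-; apply: nbr_irrefl.
have := reachable_marked (reachable_bob rh oh wh) (v := v).
rewrite mem_rcons inE (negPf vw) vh set_rcons markedU1 ?inE // => /(_ isT).
by rewrite -in_nbr wv add1n ltnNge s_le.
Qed.

Lemma bob_position_moves (S : {set G}) w : bob_position S -> w \notin S ->
  w |: S = setT \/ exists a, [/\ a \notin w |: S, (marked (w |: S) a <= s)%N
                               & bob_position (a |: (w |: S))].
Proof.
move=> [h [rh oh ->]]; rewrite inE => wh; rewrite -set_rcons.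
have rhw := reachable_bob rh oh wh.
have [hG|/(uniq_full rhw.1) full] := boolP (size (rcons h w) < #|G|)%N; last first.
  by left; apply/setP => x; rewrite !inE full.
right; have [|a ah ra] := reachable_alice rhw _ hG; first by rewrite size_rcons /= oh.
exists a; split; rewrite ?inE //; first exact: reachable_marked.
exists (rcons (rcons h w) a); split=> //; first by rewrite !size_rcons /= negbK.
by rewrite [RHS]set_rcons.
Qed.

Lemma bob_position_first : (0 < #|G|)%N -> exists a, bob_position [set a].
Proof.
move=> G_gt0; have r0 : reachable [::] by split=> // -[].
have [//|//|a _ ra] := reachable_alice r0; exists a, [:: a]; split=> //.
by apply/setP => x; rewrite !inE.
Qed.

End Plays.

Lemma bob_defeats_4 (G : sgraph) (K Z : {set G}) (n : nat) :
  (forall v, v \in K -> #|nbr v| = 4%N) ->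
  (forall v, v \in K -> (core_deg K v <= 3)%N) ->
  (forall w, w \notin K -> (core_deg K w <= 1)%N) ->
  (forall z, z \in Z -> (z \in K) && (core_deg K z <= 2)%N) ->
  (forall u, (#|[set z in Z | u \in ball2 z]%SET| <= 1)%N) ->
  (0 < #|G|)%N -> (n.*2 <= #|Z|)%N -> 0 < Psi K finset.set0 + n.*2%:Z ->
  ~ Alice_guarantees G 4.
Proof.
move=> deg4 deg3 leaf1 ZK Zfar G_gt0 nZ gt0 [sigma legal_s wins].
apply: (bob_wins deg4 deg3 leaf1 (bob_turn := bob_position sigma) _ _ ZK Zfar _ nZ gt0).
- move=> S v BS vK vS; rewrite -ltnS.
  by apply: (bob_position_marked legal_s wins BS); rewrite ?deg4.
- by move=> S w; apply: bob_position_moves.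
- exact: bob_position_first.
Qed.

(** * Pinning down the game coloring number *)

Lemma alice_guarantees_max_degree (G : sgraph) (d : nat) :
  (forall v : G, (#|nbr v| <= d)%N) -> Alice_guarantees G d.+1.
Proof.
move=> deg_le; exists (fun h => [pick v | v \notin h]).
  move=> h _ hG _; case: pickP => [v vh|all_in]; first by exists v.
  suff : (#|G| <= size h)%N by rewrite leqNgt hG.
  by rewrite cardE; apply: uniq_leq_size (enum_uniq _) _ => v _;
    apply/negbNE/negbT/all_in.
move=> p _ _ v; rewrite addn1 ltnS; apply: leq_trans (deg_le v).
by apply: subset_leq_card; apply/fintype.subsetP => u; rewrite !inE => /andP[].
Qed.

(** Guarantees are monotone in the bound, so refuting [s] refutes everything below it. *)
Lemma col_g_eq (G : sgraph) (s : nat) :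
  Alice_guarantees G s.+1 -> ~ Alice_guarantees G s -> col_g G = s.+1.
Proof.
move=> wins_s1 loses_s; rewrite /col_g; case: ex_minnP => m /asboolP wins_m min_m.
apply/eqP; rewrite eqn_leq min_m; last by apply/asboolP.
rewrite ltnNge; apply/negP => m_le; apply: loses_s.
case: wins_m => sigma legal_s wins; exists sigma => // p cp fp v.
exact: leq_trans (wins p cp fp v) m_le.
Qed.

(** * Straight-line drawings *)

Definition zpoint : Type := Z * Z.

(* Z rather than int keeps the computation on coordinates binary. *)
Definition orient (a b c : zpoint) : Z :=
  ((b.1 - a.1) * (c.2 - a.2) - (b.2 - a.2) * (c.1 - a.1))%BZ.

Definition inner (a b c : zpoint) : Z :=
  ((b.1 - a.1) * (c.1 - a.1) + (b.2 - a.2) * (c.2 - a.2))%BZ.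

Definition left_of (a b c d : Z) : bool :=
  [&& (a <? c)%BZ, (a <? d)%BZ, (b <? c)%BZ & (b <? d)%BZ].

(** A sufficient test for disjoint segments: separated projections on an axis, or one segment
    strictly on one side of the line through the other. *)
Definition apart (a b c d : zpoint) : bool :=
  [|| left_of a.1 b.1 c.1 d.1, left_of c.1 d.1 a.1 b.1,
      left_of a.2 b.2 c.2 d.2, left_of c.2 d.2 a.2 b.2,
      (0 <? orient a b c * orient a b d)%BZ
    | (0 <? orient c d a * orient c d b)%BZ].

(** Two segments issuing from [o] meet only there if they are not collinear or point in opposite
    directions. *)
Definition fork (o a b : zpoint) : bool :=
  ~~ (orient o a b =? 0)%BZ || (inner o a b <? 0)%BZ.

Definition zeq (a b : zpoint) : bool := ((a.1 =? b.1) && (a.2 =? b.2))%BZ.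

Definition seg_ok (e f : zpoint * zpoint) : bool :=
  if zeq e.1 f.1 then fork e.1 e.2 f.2
  else if zeq e.1 f.2 then fork e.1 e.2 f.1
  else if zeq e.2 f.1 then fork e.2 e.1 f.2
  else if zeq e.2 f.2 then fork e.2 e.1 f.1
  else apart e.1 e.2 f.1 f.2.

Lemma zeqP a b : reflect (a = b) (zeq a b).
Proof.
case: a b => [a1 a2] [b1 b2]; apply: (iffP andP) => /= [[]|[-> ->]].
  by move=> /Z.eqb_spec-> /Z.eqb_spec->.
by rewrite !Z.eqb_refl.
Qed.

Section Drawing.
Variable R : realType.
Local Open Scope classical_set_scope.

Definition zR (z : Z) : R := (int_of_Z z)%:~R.

Lemma zRD a b : zR (a + b)%BZ = zR a + zR b.
Proof. by rewrite /zR (rmorphD int_of_Z) rmorphD. Qed.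

Lemma zRB a b : zR (a - b)%BZ = zR a - zR b.
Proof. by rewrite /zR (rmorphB int_of_Z) rmorphB. Qed.

Lemma zRM a b : zR (a * b)%BZ = zR a * zR b.
Proof. by rewrite /zR (rmorphM int_of_Z) rmorphM. Qed.

Lemma ltr_zR a b : (a <? b)%BZ -> zR a < zR b.
Proof. by rewrite /zR ltr_int; lia. Qed.

Lemma eq_zR a b : (zR a == zR b) = (a =? b)%BZ.
Proof. by rewrite /zR eqr_int; lia. Qed.

Lemma zR0 : zR 0 = 0. Proof. by []. Qed.

Definition point (a : zpoint) : R * R := (zR a.1, zR a.2).

Lemma point_inj : injective point.
Proof.
move=> a b [/eqP e1 /eqP e2]; apply/zeqP.
by rewrite /zeq -!eq_zR e1 e2.
Qed.

Definition segment (a b : zpoint) : set (R * R) :=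
  [set ((1 - t) * zR a.1 + t * zR b.1, (1 - t) * zR a.2 + t * zR b.2)
     | t in `[0, 1]].

Lemma segmentC a b : segment a b = segment b a.
Proof.
suff sub x y : segment x y `<=` segment y x by apply/seteqP; split; apply: sub.
move=> _ [t + <-]; rewrite /= in_itv /= => /andP[t0 t1].
exists (1 - t); first by rewrite /= in_itv /=; apply/andP; split; lra.
by rewrite opprB addrCA subrr addr0 [X in (X, _)]addrC [X in (_, X)]addrC.
Qed.

Lemma segment_arc a b : a <> b -> is_arc (segment a b) (point a) (point b).
Proof.
move=> ab; exists (fun t => ((1 - t) * zR a.1 + t * zR b.1,
                            (1 - t) * zR a.2 + t * zR b.2)).
split=> //; last 2 first.
- by rewrite subr0 !mul1r !mul0r !addr0.
- by rewrite subrr !mul1r !mul0r !add0r.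
- apply: continuous_subspaceT => t.
  have cont (x y : R) : (fun t : R => (1 - t) * x + t * y) @ t --> (1 - t) * x + t * y.
    apply: cvgD; apply: cvgMl => //; apply: cvgB; [exact: cvg_cst|exact: cvg_id].
  exact: cvg_pair (cont _ _) (cont _ _).
move=> s t _ _ [e1 e2]; apply/eqP; rewrite -subr_eq0; apply: contraT => st.
exfalso; apply: ab; apply/point_inj; congr pair; apply/eqP; rewrite -subr_eq0;
  rewrite -(mulrI_eq0 _ (mulfI st)); apply/eqP; lra.
Qed.

Lemma convex_gt0 (x y t : R) : 0 < x -> 0 < y -> 0 <= t <= 1 ->
  0 < (1 - t) * x + t * y.
Proof.
move=> x0 y0 /andP[]; rewrite le_eqVlt => /orP[/eqP<- _|t0 t1].
  by rewrite subr0 mul1r mul0r addr0.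
by apply: ltr_wpDl; [apply: mulr_ge0; lra | exact: mulr_gt0].
Qed.

Lemma left_of_neq (a b c d : Z) (s t : R) : left_of a b c d ->
  0 <= s <= 1 -> 0 <= t <= 1 ->
  (1 - s) * zR a + s * zR b <> (1 - t) * zR c + t * zR d.
Proof.
move=> /and4P[/ltr_zR ac /ltr_zR ad /ltr_zR bc /ltr_zR bd] s01 t01.
rewrite -subr_gt0 in ac; rewrite -subr_gt0 in ad.
rewrite -subr_gt0 in bc; rewrite -subr_gt0 in bd.
have := convex_gt0 (convex_gt0 ac ad t01) (convex_gt0 bc bd t01) s01.
by move=> /[swap] eq_st; apply/negP; rewrite -leNgt; move: eq_st; lra.
Qed.

Lemma zR_orient a b c : zR (orient a b c) =
  (zR b.1 - zR a.1) * (zR c.2 - zR a.2) - (zR b.2 - zR a.2) * (zR c.1 - zR a.1).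
Proof. by rewrite /orient zRB !zRM !zRB. Qed.

Lemma zR_inner a b c : zR (inner a b c) =
  (zR b.1 - zR a.1) * (zR c.1 - zR a.1) + (zR b.2 - zR a.2) * (zR c.2 - zR a.2).
Proof. by rewrite /inner zRD !zRM !zRB. Qed.

(* Affine functions vanishing on ab keep a constant sign on cd. *)
Lemma same_side_disjoint a b c d : (0 <? orient a b c * orient a b d)%BZ ->
  segment a b `&` segment c d = set0.
Proof.
move=> /ltr_zR; rewrite zR0 zRM => side.
apply/seteqP; split=> // p [[s _ <-]] [t]; rewrite /= in_itv /= => /andP[t0 t1] [e1 e2].
have : (1 - t) * zR (orient a b c) + t * zR (orient a b d) = 0.
  transitivity ((zR b.1 - zR a.1) * (((1 - t) * zR c.2 + t * zR d.2) - zR a.2) -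
    (zR b.2 - zR a.2) * (((1 - t) * zR c.1 + t * zR d.1) - zR a.1)).
    by rewrite !zR_orient; ring.
  by rewrite e1 e2; ring.
move: side; set x := zR (orient a b c); set y := zR (orient a b d) => xy eq0.
have x0 : x != 0 by apply: contraTneq xy => ->; rewrite mul0r ltxx.
have : 0 < (1 - t) * (x * x) + t * (x * y).
  by apply: convex_gt0; rewrite ?t0 //; rewrite -expr2 exprn_even_gt0.
suff -> : (1 - t) * (x * x) + t * (x * y) = x * ((1 - t) * x + t * y).
  by rewrite eq0 mulr0 ltxx.
by ring.
Qed.

Lemma apart_disjoint a b c d : apart a b c d -> segment a b `&` segment c d = set0.
Proof.
rewrite /apart => /orP[|/orP[|/orP[|/orP[|/orP[]]]]] H;
  try (by apply: same_side_disjoint);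
  try (by rewrite setIC; apply: same_side_disjoint);
  apply/seteqP; split=> // p [[s + <-]] [t]; rewrite /= !in_itv /= => s01 t01 [e1 e2].
- by apply: (left_of_neq H s01 t01).
- by apply: (left_of_neq H t01 s01).
- by apply: (left_of_neq H s01 t01).
- by apply: (left_of_neq H t01 s01).
Qed.

(** A common point gives s(a - o) = t(b - o). A nonzero cross product forces t = 0; a negative inner
    product makes the squared norm of s(a - o) at most 0. *)
Lemma fork_meet o a b p : fork o a b ->
  segment o a p -> segment o b p -> p = point o.
Proof.
move=> ok [s + <-] [t]; rewrite /= !in_itv /= => /andP[s0 s1] /andP[t0 t1] [e1 e2].
have {}e1 : t * (zR b.1 - zR o.1) = s * (zR a.1 - zR o.1) by lra.
have {}e2 : t * (zR b.2 - zR o.2) = s * (zR a.2 - zR o.2) by lra.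
suff [z1 z2] : s * (zR a.1 - zR o.1) = 0 /\ s * (zR a.2 - zR o.2) = 0.
  by rewrite /point; congr pair; lra.
case/orP: ok => [|/ltr_zR]; rewrite -?eq_zR ?zR0 ?zR_orient ?zR_inner.
  set A1 := zR a.1 - zR o.1 in e1 *; set A2 := zR a.2 - zR o.2 in e2 *.
  set B1 := zR b.1 - _ in e1 *; set B2 := zR b.2 - _ in e2 *.
  move=> ne0; have : t * (A1 * B2 - A2 * B1) = 0.
    rewrite mulrBr !(mulrCA t) e2 e1; ring.
  move/eqP; rewrite mulf_eq0 (negPf ne0) orbF => /eqP tE.
  by rewrite -e1 -e2 tE !mul0r.
set A1 := zR a.1 - zR o.1 in e1 *; set A2 := zR a.2 - zR o.2 in e2 *.
set B1 := zR b.1 - _ in e1 *; set B2 := zR b.2 - _ in e2 * => neg.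
have : (s * A1) ^+ 2 + (s * A2) ^+ 2 = s * t * (A1 * B1 + A2 * B2).
  by rewrite !expr2 -{2}e1 -{2}e2; ring.
have : s * t * (A1 * B1 + A2 * B2) <= 0.
  by apply: mulr_ge0_le0; [exact: mulr_ge0 | exact: ltW].
move=> le0 eq0; have := sqr_ge0 (s * A1); have := sqr_ge0 (s * A2) => ge2 ge1.
by split; apply/eqP; rewrite -sqrf_eq0; apply/eqP; lra.
Qed.

Lemma seg_ok_meet e f p : seg_ok e f ->
  segment e.1 e.2 p -> segment f.1 f.2 p ->
  exists q, [/\ q = e.1 \/ q = e.2, q = f.1 \/ q = f.2 & p = point q].
Proof.
case: e f => [a b] [c d]; rewrite /seg_ok /=.
case: zeqP => [<-|_]; first by move=> ok pe pf; exists a; split;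
  [left | left | exact: fork_meet ok pe pf].
case: zeqP => [<-|_]; first by rewrite (segmentC c) => ok pe pf; exists a; split;
  [left | right | exact: fork_meet ok pe pf].
case: zeqP => [<-|_]; first by rewrite (segmentC a) => ok pe pf; exists b; split;
  [right | left | exact: fork_meet ok pe pf].
case: zeqP => [<-|_]; first by rewrite (segmentC a) (segmentC c) => ok pe pf;
  exists b; split; [right | right | exact: fork_meet ok pe pf].
move=> /apart_disjoint/seteqP[H _] pe pf.
by case: (H p).
Qed.

(** Only pairs of edges need testing: since every vertex has a neighbour, a vertex lying on a
    foreign edge would be a meeting point of two edges away from a common end. *)
Lemma planar_segments (G : sgraph) (pos : G -> zpoint) (es : seq (zpoint * zpoint)) :
  injective pos -> (forall u : G, exists v, adj u v) ->
  (forall u v, adj u v -> (pos u, pos v) \in es \/ (pos v, pos u) \in es) ->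
  pairwise seg_ok es -> planar R G.
Proof.
move=> pos_inj deg_gt0 es_adj ok.
have meet u v x y p : adj u v -> adj x y -> [set u; v]%SET != [set x; y]%SET ->
    segment (pos u) (pos v) p -> segment (pos x) (pos y) p ->
    exists w, [/\ w \in [set u; v]%SET, w \in [set x; y]%SET & p = point (pos w)].
  move=> uv xy neq pe pf.
  have edge a b : adj a b -> exists2 e : zpoint * zpoint, e \in es &
      segment e.1 e.2 = segment (pos a) (pos b) /\
      (e = (pos a, pos b) \/ e = (pos b, pos a)).
    by case/es_adj => H; [exists (pos a, pos b) | exists (pos b, pos a)] => //;
      split; rewrite 1?segmentC //; [left|right].
  have [e ee [eS eE]] := edge u v uv; have [f fe [fS fE]] := edge x y xy.
  have ef : e <> f.
    move=> ef; case/negP: neq; apply/eqP/setP => w; rewrite !inE.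
    case: eE fE ef => [->|->] [->|->] [/pos_inj-> /pos_inj->] //; exact: orbC.
  have [q [qe qf ->]] : exists q,
      [/\ q = e.1 \/ q = e.2, q = f.1 \/ q = f.2 & p = point q].
    rewrite -eS in pe; rewrite -fS in pf.
    have [i ilt ei] := nthP e ee; have [j jlt fj] := nthP e fe.
    have {}ok := elimT (pairwiseP e) ok.
    case: (ltngtP i j) => [ij|ji|ij].
    - by have := ok i j ilt jlt ij; rewrite ei fj => /seg_ok_meet; apply.
    - have := ok j i jlt ilt ji; rewrite ei fj => /seg_ok_meet H.
      by have [q [? ? ?]] := H p pf pe; exists q.
    - by case: ef; rewrite -ei -fj ij.
  have {}qe : q = pos u \/ q = pos v by case: eE qe => -> /= []; [left|right|right|left].
  have {}qf : q = pos x \/ q = pos y by case: fE qf => -> /= []; [left|right|right|left].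
  have [w [wuv wxy ->]] : exists w,
      [/\ w \in [set u; v]%SET, w \in [set x; y]%SET & q = pos w].
    case: qe => qE; [exists u|exists v]; split=> //; rewrite !inE ?eqxx ?orbT //;
      by case: qf; rewrite qE => /pos_inj->; rewrite eqxx ?orbT.
  by exists w.
exists (point \o pos), (fun u v => segment (pos u) (pos v)); split.
- by move=> u v /point_inj/pos_inj.
- move=> u v uv; split; first exact: segmentC.
  by apply: segment_arc => /pos_inj uvE; rewrite uvE adj_irrefl in uv.
- move=> u v w uv pw; apply: contraT => wuv.
  have [x wx] := deg_gt0 w.
  have [||z [zuv zwx /point_inj/pos_inj wz]] := meet u v w x _ uv wx _ pw.
  + by apply: contraNneq wuv => ->; rewrite !inE eqxx.
  + exists 0; first by rewrite /= in_itv /= lexx ler01.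
    by rewrite subr0 !mul1r !mul0r !addr0.
  by rewrite wz zuv in wuv.
- move=> u v x y uv xy neq p [pe pf].
  by have [w [wuv wxy ->]] := meet _ _ _ _ _ uv xy neq pe pf; exists w.
Qed.

End Drawing.

(** * The graph *)

Definition vcode : Type := nat * nat * nat.

(* (0, i, a) is the core vertex on ring i and ray a; (1, i, a) and (2, i, a) are
   its outer and inner leaves, in use only where it has no spoke on that side;
   (k, i, 0) with 3 <= k <= 8 is the i-th vertex of the disjoint k-cycle. *)
Definition rings : nat := 20.

(** Three spokes join consecutive rings, three rays apart and shifted by one ray from ring to ring.
    A core vertex thus has at most one spoke, and none when i + a is 2 modulo 3. *)
Definition spoke (i a : nat) : bool := ((i + a) %% 3 == 0)%N.

Definition code_nbr (c : vcode) : seq vcode :=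
  let: (t, i, a) := c in
  match t with
  | 0 => [:: (0, i, a.+1 %% 9); (0, i, (a + 8) %% 9);
             if spoke i a && (i.+1 < rings) then (0, i.+1, a) else (1, i, a);
             if (0 < i) && spoke i.-1 a then (0, i.-1, a) else (2, i, a)]
  | 1 | 2 => [:: (0, i, a)]
  | _ => [:: (t, i.+1 %% t, 0); (t, (i + t.-1) %% t, 0)]
  end%N.

Definition core_codes : seq vcode :=
  [seq (0, i, a)%N | i <- iota 0 rings, a <- iota 0 9].

Definition leaf_codes : seq vcode :=
  flatten [seq [seq d <- code_nbr c | d.1.1 != 0%N] | c <- core_codes].

Definition cycle_codes (k : nat) : seq vcode := [seq (k, i, 0)%N | i <- iota 0 k].

Definition graph_codes (k : nat) : seq vcode :=
  core_codes ++ leaf_codes ++ cycle_codes k.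

(* Contains all the k-cycles at once, so that each check runs only once. *)
Definition all_codes : seq vcode :=
  core_codes ++ leaf_codes ++ flatten [seq cycle_codes k | k <- iota 3 6].

(** Nine directions of increasing angle; the polygon through them is star-shaped about the origin,
    so its dilates are disjoint. *)
Definition ray (a : nat) : zpoint :=
  nth (0, 0)%BZ [:: (1, 0); (2, 1); (1, 1); (0, 1); (-1, 1); (-1, 0); (-1, -1);
                   (0, -1); (1, -1)]%BZ a.

(** Scale step 3 leaves room for an outer and an inner leaf between rings. The core stays within
    abscissa 122; each k-cycle lies beyond it as a convex polygon on a translated parabola, in its
    own strip of width 20. *)
Definition code_pos (c : vcode) : zpoint :=
  let: (t, i, a) := c in
  let r := (3 * (Z.of_nat i + 1))%BZ in
  let at_radius r := (r * (ray a).1, r * (ray a).2)%BZ in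
  match t with
  | 0 => at_radius r
  | 1 => at_radius (r + 1)%BZ
  | 2 => at_radius (r - 1)%BZ
  | _ => (200 + 20 * Z.of_nat t + Z.of_nat i, Z.of_nat i * Z.of_nat i)%BZ
  end.

(** The lexicographic test keeps one direction of each edge, since an edge and its reverse would
    fail [seg_ok]. *)
Definition code_segments : seq (zpoint * zpoint) :=
  flatten [seq [seq (code_pos c, code_pos d) | d <- code_nbr c
     & let p := code_pos c in let q := code_pos d in
       (p.1 <? q.1)%BZ || (p.1 =? q.1)%BZ && (p.2 <? q.2)%BZ] | c <- all_codes].

Definition is_core (c : vcode) : bool := (c.1.1 == 0)%N.

(** One vertex per ring, with i + (5i + 2) equal to 2 modulo 3 and hence no spoke; the shift by 5
    keeps the balls disjoint. *)
Definition opening_codes : seq vcode := [seq (0, i, (5 * i + 2) %% 9)%N | i <- iota 0 rings].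

Definition code_ball (c : vcode) : seq vcode :=
  code_nbr c ++ flatten (map code_nbr (code_nbr c)).

Definition code_girth (c : vcode) : nat := if (c.1.1 < 3)%N then 8 else c.1.1.

(* A walk that never backtracks goes from prev through cur to start in at most f
   more steps. *)
Fixpoint returns (f : nat) (start prev cur : vcode) : bool :=
  if f is f'.+1 then
    has (fun d => (d != prev) && ((d == start) || returns f' start cur d))
      (code_nbr cur)
  else false.

(** * Finite checks on the codes *)

Lemma code_pos_uniq : uniq (map code_pos all_codes).
Proof. by vm_compute. Qed.

Lemma code_segments_ok : pairwise seg_ok code_segments.
Proof. by vm_compute. Qed.

Lemma code_nbr_ok : all (fun c => [&& uniq (code_nbr c), c \notin code_nbr c,
  (0 < size (code_nbr c))%N & all (fun d => c \in code_nbr d) (code_nbr c)]) all_codes.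
Proof. by vm_compute. Qed.

Lemma code_nbr_closed : all (fun c => all [in core_codes ++ leaf_codes] (code_nbr c))
  (core_codes ++ leaf_codes).
Proof. by vm_compute. Qed.

Lemma cycle_nbr_closed : all (fun k => all (fun c => all [in cycle_codes k] (code_nbr c))
  (cycle_codes k)) (iota 3 6).
Proof. by vm_compute. Qed.

Lemma code_degree : all (fun c => let d := count is_core (code_nbr c) in
  if is_core c then (size (code_nbr c) == 4) && (d <= 3)
  else (size (code_nbr c) <= 2) && (d <= 1))%N all_codes.
Proof. by vm_compute. Qed.

Lemma opening_codes_ok : [&& uniq opening_codes, all [in core_codes] opening_codes &
  all (fun c => is_core c && (count is_core (code_nbr c) <= 2)%N) opening_codes].
Proof. by vm_compute. Qed.

Lemma opening_codes_far : all (fun c => count (fun z => c \in code_ball z) opening_codes <= 1)%N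
  all_codes.
Proof. by vm_compute. Qed.

(** The first edge is taken before [returns] starts, so [code_girth c - 2] further steps cover all
    lengths below [code_girth c]. *)
Lemma code_girth_ok : all (fun c =>
  ~~ has (returns (code_girth c - 2) c c) (code_nbr c)) all_codes.
Proof. by vm_compute. Qed.

(** 180 core vertices, 180 ring edges and 57 spokes give 6 * 237 - 8 * 180 = -18. *)
Lemma code_psi : foldr (fun c (s : int) => (count is_core (code_nbr c))%:Z *+ 3 - 8 + s) 0
  core_codes = - 18%:Z.
Proof. by vm_compute. Qed.

Lemma cycle_codes_cycle : all (fun k =>
  cycle (fun c d => d \in code_nbr c) (cycle_codes k)) (iota 3 6).
Proof. by vm_compute. Qed.

(** * The graph on a list of codes closed under adjacency *)

Section SubGraph.
Variable vs : seq vcode.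
Hypothesis vs_sub : {subset vs <= all_codes}.
Hypothesis vs_closed : forall c, c \in vs -> {subset code_nbr c <= vs}.
Hypothesis vs_uniq : uniq vs.

Let V : finType := seq_sub vs.

Definition code_adj (u v : V) : bool := val v \in code_nbr (val u).

Lemma vs_nbr_ok (u : V) : [&& uniq (code_nbr (val u)), val u \notin code_nbr (val u),
  (0 < size (code_nbr (val u)))%N
  & all (fun d => val u \in code_nbr d) (code_nbr (val u))].
Proof. by have := allP code_nbr_ok (val u); apply; apply/vs_sub/valP. Qed.

Lemma code_adj_sym : symmetric code_adj.
Proof.
suff sub u v : code_adj u v -> code_adj v u by move=> u v; apply/idP/idP; apply: sub.
by have /and4P[_ _ _ /allP nb] := vs_nbr_ok u; apply: nb.
Qed.

Lemma code_adj_irrefl : irreflexive code_adj.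
Proof. by move=> u; have /and4P[_ /negPf] := vs_nbr_ok u. Qed.

Definition code_graph : sgraph := SGraph code_adj_sym code_adj_irrefl.

Lemma card_val (s : seq vcode) : uniq s -> {subset s <= vs} ->
  #|[set u : code_graph | val u \in s]%SET| = size s.
Proof.
move=> us sub; rewrite cardE -(size_map val); apply/perm_size/uniq_perm => //.
  by rewrite map_inj_uniq ?enum_uniq //; apply: val_inj.
move=> c; apply/mapP/idP => [[u]|cs]; first by rewrite mem_enum inE => /[swap] ->.
by exists (SeqSub (sub c cs)) => //; rewrite mem_enum inE.
Qed.

Definition core_set : {set code_graph} := [set u : code_graph | is_core (val u)]%SET.

Lemma card_nbr (v : code_graph) : #|nbr v| = size (code_nbr (val v)).
Proof.
have /and4P[u _ _ _] := vs_nbr_ok v.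
rewrite -(card_val u (vs_closed (valP v))); apply: eq_card => x.
by rewrite in_nbr finset.in_set; apply: code_adj_sym.
Qed.

Lemma core_degE (v : code_graph) :
  core_deg core_set v = count is_core (code_nbr (val v)).
Proof.
have /and4P[u _ _ _] := vs_nbr_ok v.
rewrite -size_filter -card_val ?filter_uniq //; last first.
  by move=> c; rewrite mem_filter => /andP[_]; apply: vs_closed (valP v) _.
apply: eq_card => x; rewrite finset.in_setI in_nbr !finset.in_set mem_filter andbC; congr andb.
exact: code_adj_sym.
Qed.

Lemma code_pos_inj : injective (fun u : code_graph => code_pos (val u)).
Proof.
move=> u v eq_pos; apply: val_inj.
have /(nthP (0, 0, 0)%N)[i ilt iE] : val u \in all_codes by apply/vs_sub/valP.
have /(nthP (0, 0, 0)%N)[j jlt jE] : val v \in all_codes by apply/vs_sub/valP.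
have := nth_uniq (0, 0)%BZ _ _ code_pos_uniq (i := i) (j := j).
rewrite size_map !(nth_map (0, 0, 0)%N) // iE jE eq_pos eqxx => /(_ ilt jlt).
by move/esym/eqP => ij; rewrite -iE -jE ij.
Qed.

Lemma code_graph_planar (R : realType) : planar R code_graph.
Proof.
apply: (@planar_segments R code_graph (code_pos \o val) code_segments).
- exact: code_pos_inj.
- move=> u; have /and4P[_ _ + _] := vs_nbr_ok u.
  rewrite -card_nbr => /card_gt0P[v]; rewrite in_nbr => vu.
  by exists v; rewrite adj_sym.
- suff half u v : code_adj u v -> let p := code_pos (val u) in let q := code_pos (val v) in
      (p.1 <? q.1)%BZ || (p.1 =? q.1)%BZ && (p.2 <? q.2)%BZ ->
      (p, q) \in code_segments.
    move=> u v uv; pose p := code_pos (val u); pose q := code_pos (val v).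
    have [pq|qp] : (p.1 <? q.1)%BZ || (p.1 =? q.1)%BZ && (p.2 <? q.2)%BZ \/
        (q.1 <? p.1)%BZ || (q.1 =? p.1)%BZ && (q.2 <? p.2)%BZ.
      have : ~~ zeq p q.
        by apply/negP => /zeqP/code_pos_inj uvE; rewrite uvE adj_irrefl in uv.
      by rewrite /zeq; lia.
    by left; apply: half.
    by right; apply: half => //; rewrite code_adj_sym.
  move=> uv p q pq; apply/flatten_mapP; exists (val u); first by apply/vs_sub/valP.
  by apply/mapP; exists (val v) => //; rewrite mem_filter; apply/andP.
- exact: code_segments_ok.
Qed.

(** A path without repetition never backtracks; the condition on empty [s] excludes closing up
    through the edge just used. *)
Lemma returns_path f start prev cur s :
  path (fun c d => d \in code_nbr c) cur (rcons s start) ->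
  uniq (prev :: cur :: s) -> start \notin cur :: s ->
  (s = [::] -> prev != start) -> (size s < f)%N -> returns f start prev cur.
Proof.
elim: f prev cur s => // f IHf prev cur [|d s] /=.
  rewrite andbT => sc _ _ /(_ erefl) ps _; apply/hasP; exists start => //.
  by rewrite eq_sym ps eqxx.
move=> /andP[dc pth] /and3P[pcd cds uds] sn _ sf; apply/hasP; exists d => //.
have -> : d != prev by apply: contraNneq pcd => <-; rewrite !inE eqxx orbT.
apply/orP; right; apply: (IHf _ _ s) => //=; rewrite ?cds //.
  by apply: contra sn; rewrite !inE => ->; rewrite orbT.
by move=> _; apply: contraNneq sn => ->; rewrite inE eqxx.
Qed.

Lemma cycle_size (c : seq code_graph) : is_cycle c ->
  exists2 u : code_graph, u \in c & (code_girth (val u) <= size c)%N.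
Proof.
case: c => [|x0 [|x1 [|x2 s]]] // /andP[_ /andP[cyc ucyc]].
exists x0; first by rewrite inE eqxx.
have x0_all : val x0 \in all_codes by apply/vs_sub/valP.
have := allP code_girth_ok _ x0_all; apply: contraNT; rewrite -ltnNge => lt_size.
have {}cyc : path (fun c d => d \in code_nbr c) (val x0)
    (rcons (map val (x1 :: x2 :: s)) (val x0)).
  by rewrite -map_rcons path_map.
have {}ucyc : uniq (map val (x0 :: x1 :: x2 :: s)) by rewrite map_inj_uniq //; apply: val_inj.
move: cyc; rewrite /= => /andP[x01 pth]; apply/hasP; exists (val x1) => //.
apply: (returns_path (s := map val (x2 :: s))) => //.
  by move: ucyc; rewrite map_cons cons_uniq => /andP[].
by rewrite size_map ltn_subRL.
Qed.

Lemma lift_codes (s : seq vcode) : {subset s <= vs} ->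
  exists t : seq code_graph, map val t = s.
Proof.
elim: s => [|c s IHs] sub; first by exists [::].
have [|t tE] := IHs; first by move=> d ds; apply: sub; rewrite inE ds orbT.
have cs : c \in vs by apply: sub; rewrite inE eqxx.
by exists (SeqSub cs :: t); rewrite /= tE.
Qed.

Lemma code_graph_alice : Alice_guarantees code_graph 5.
Proof.
apply: alice_guarantees_max_degree => v; rewrite card_nbr.
have := allP code_degree (val v) (vs_sub (valP v)).
by rewrite /=; case: ifP => _ /andP[+ _]; [move/eqP-> | move/leq_trans; apply].
Qed.

Hypothesis core_vs : {subset core_codes <= vs}.
Hypothesis core_vsP : forall c, c \in vs -> is_core c -> c \in core_codes.

Lemma code_graph_psi : Psi core_set finset.set0 = - 18%:Z.
Proof.
rewrite /Psi /potential finset.setD0.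
under eq_bigr => v _.
  rewrite core_degE /marked finset.set0D finset.setI0 cards0 !addr0; over.
rewrite -big_enum -(big_map val xpredT (fun c => (count is_core (code_nbr c))%:Z *+ 3 - 8)).
rewrite (perm_big core_codes) /=; last first.
  apply: uniq_perm; first by rewrite map_inj_uniq ?enum_uniq //; apply: val_inj.
    by have := map_uniq code_pos_uniq; rewrite cat_uniq => /andP[].
  move=> c; apply/mapP/idP => [[u]|cc].
    by rewrite mem_enum inE => uc ->; apply: core_vsP => //; apply: valP.
  exists (SeqSub (core_vs cc)) => //; rewrite mem_enum inE /=.
  by case/allpairsP: (cc) => -[i a] [_ _ ->].
by rewrite -code_psi; elim: core_codes => [|c s IHs]; rewrite ?big_nil // big_cons IHs.
Qed.

Lemma code_graph_bob : ~ Alice_guarantees code_graph 4.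
Proof.
have deg (v : code_graph) := allP code_degree (val v) (vs_sub (valP v)).
have /and3P[uz /allP z_core /allP z_ok] := opening_codes_ok.
have z_vs : {subset opening_codes <= vs} by move=> z /z_core/core_vs.
pose Z : {set code_graph} := [set u : code_graph | val u \in opening_codes]%SET.
have ballE (u z : code_graph) : (u \in ball2 z) = (val u \in code_ball (val z)).
  rewrite inE in_nbr adj_sym mem_cat; congr orb.
  apply/bigcupP/flatten_mapP => -[x].
    rewrite !in_nbr => xz ux; exists (val x); last by rewrite adj_sym in ux.
    by rewrite adj_sym in xz.
  move=> xz ux; have xs := vs_closed (valP z) xz.
  by exists (SeqSub xs); rewrite in_nbr adj_sym.
(* Ten opening moves consume the bound of 20 given by the opening vertices and bring [Psi] from -18
   to at least 2. *)
apply: (@bob_defeats_4 code_graph core_set Z 10).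
- move=> v; rewrite inE card_nbr => vc; have := deg v.
  by rewrite /= vc => /andP[/eqP].
- move=> v; rewrite inE core_degE => vc; have := deg v.
  by rewrite /= vc => /andP[].
- move=> v; rewrite finset.in_set core_degE => /negPf vc; have := deg v.
  by rewrite vc => /andP[].
- by move=> z; rewrite !finset.in_set core_degE; apply: z_ok.
- move=> u.
  have : (count (fun z => val u \in code_ball z) opening_codes <= 1)%N.
    exact: allP opening_codes_far (val u) (vs_sub (valP u)).
  rewrite -size_filter -card_val ?filter_uniq //; last first.
    by move=> c; rewrite mem_filter => /andP[_ /z_vs].
  apply: leq_trans; apply: subset_leq_card; apply/fintype.subsetP => z.
  by rewrite finset.in_set ballE !finset.in_set mem_filter andbC.
- apply/card_gt0P; have c0 : (0, 0, 0)%N \in vs by apply: core_vs; vm_compute.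
  by exists (SeqSub c0).
- by rewrite (card_val uz z_vs).
- by rewrite code_graph_psi.
Qed.

Lemma code_graph_col_g : col_g code_graph = 5%N.
Proof. exact: col_g_eq code_graph_alice code_graph_bob. Qed.

End SubGraph.

(** * The graph with a disjoint k-cycle and its girth *)

Lemma cycle_codes_subseq : all (fun k =>
  subseq (cycle_codes k) (flatten [seq cycle_codes j | j <- iota 3 6])) (iota 3 6).
Proof. by vm_compute. Qed.

Lemma non_core_codes : all (fun c => ~~ is_core c)
  (leaf_codes ++ flatten [seq cycle_codes j | j <- iota 3 6]).
Proof. by vm_compute. Qed.

Lemma graph_codes_girth : all (fun k =>
  all (fun c => k <= code_girth c)%N (graph_codes k)) (iota 3 6).
Proof. by vm_compute. Qed.

Lemma exists_planar_girth_col_g (R : realType) (k : nat) : (3 <= k <= 8)%N ->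
  exists G : sgraph, [/\ planar R G, girth R G = k%:R%:E & col_g G = 5%N].
Proof.
move=> hk; have {hk}kI : k \in iota 3 6 by rewrite mem_iota.
have sub_all : subseq (graph_codes k) all_codes.
  apply: cat_subseq (subseq_refl _) (cat_subseq (subseq_refl _) _).
  exact: (allP cycle_codes_subseq).
have vs_sub := mem_subseq sub_all.
have vs_uniq := subseq_uniq sub_all (map_uniq code_pos_uniq).
have vs_closed c : c \in graph_codes k -> {subset code_nbr c <= graph_codes k}.
  rewrite /graph_codes catA mem_cat => /orP[cE|cE] d dc; rewrite mem_cat.
    by have /allP/(_ d dc) := allP code_nbr_closed c cE => ->.
  have /allP/(_ c cE)/allP/(_ d dc) := allP cycle_nbr_closed k kI.
  by move=> /= ->; rewrite orbT.
have core_vs : {subset core_codes <= graph_codes k}.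
  by move=> c cE; rewrite mem_cat cE.
have core_vsP c : c \in graph_codes k -> is_core c -> c \in core_codes.
  move=> /vs_sub; rewrite mem_cat => /orP[//|cE].
  by have /negPf-> := allP non_core_codes c cE.
pose G := code_graph vs_sub; exists G; split.
- exact: code_graph_planar.
(* The disjoint k-cycle bounds the girth above; below, every cycle passes through a code whose
   [code_girth] is at least k. *)
- apply/eqP; rewrite eq_le; apply/andP; split.
    have [|c cE] := @lift_codes _ vs_sub (cycle_codes k).
      by move=> c cE; rewrite /graph_codes catA mem_cat cE orbT.
    apply: ereal_inf_lbound; exists c; last first.
      by rewrite -(size_map val) cE size_map size_iota.
    rewrite /= /is_cycle /ucycleb -(size_map val) -(map_inj_uniq val_inj) cE.
    apply/and3P; split.
    + by rewrite size_map size_iota; move: kI; rewrite mem_iota => /andP[].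
    + have := allP cycle_codes_cycle k kI.
      by rewrite -cE cycle_map.
    + by move: vs_uniq; rewrite /graph_codes catA cat_uniq => /and3P[].
  apply: le_ereal_inf_tmp => _ [c c_cycle <-]; rewrite lee_fin ler_nat.
  have [u _] := cycle_size c_cycle; apply: leq_trans.
  exact: (allP (allP graph_codes_girth k kI)) (valP u).
- exact: code_graph_col_g.
Qed.

Theorem theorem3 (R : realType) (k : nat) (hk : (3 <= k <= 8)%N) :
  (exists G : sgraph,
     [/\ planar R G, girth R G = k%:R%:E & col_g G = 5%N]) /\
  (5%:R%:E <= col_g_family R (planar_girth_ge R k))%E.
Proof.
have exG := exists_planar_girth_col_g R hk; split=> //.
have [G [plG girthG colG]] := exG.
by apply: ereal_sup_ubound; exists G; [split; rewrite ?girthG | rewrite colG].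
Qed.
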